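(* Let $\mu\in\mathbb{R}$ and $x>0$. Then $$\frac{\partial \mathrm{W}_{0,\mu}(x)}{\partial\mu}=\mathrm{sgn}(\mu)\sqrt{\frac{x}{\pi}}\left.\frac{\partial K_{\nu}(x/2)}{\partial\nu}\right|_{\nu=|\mu|}.$$
   Context: For $x>0$, the Whittaker function is $\mathrm{W}_{\kappa,\mu}(x)=e^{-x/2}x^{\mu+1/2}\,\mathrm{U}\left(\frac12+\mu-\kappa,1+2\mu,x\right)$, where $\mathrm{U}$ is the Tricomi confluent hypergeometric function. $K_\nu$ is the modified Bessel function of the second kind (Macdonald function) of order $\nu$, and $\mathrm{sgn}$ is the sign function with $\mathrm{sgn}(0)=0$. *)

(* Defs.v *)
From HB Require Import structures.
From mathcomp Require Import all_boot all_order all_algebra.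
From mathcomp Require Import all_classical all_reals all_analysis.

Set Implicit Arguments.
Unset Strict Implicit.
Unset Printing Implicit Defensive.

Import Order.TTheory GRing.Theory Num.Theory.
Import numFieldNormedType.Exports.

Local Open Scope classical_set_scope.
Local Open Scope ring_scope.

Section SpecialFunctions.
Context {R : realType}.
Implicit Types (a b kappa mu nu x : R) (u : R -> R).

(* U and K are defined on the positive half-line as in the NIST handbook (DLMF,
   13.2.6 and 10.25.3): the solution of the differential equation having a
   prescribed recessive behaviour at infinity. For all real parameters there is
   exactly one such solution on ]0, +oo[, because every linearly independent
   solution grows like exp(x) times a power of x. The default value (fun=> 0)
   of xget is thus never used, and values at x <= 0 carry no meaning. *)

Definition twice_derivable u x :=
  derivable u x 1 /\ derivable (derive1 u) x 1.

Definition kummer_eq a b u := forall x, 0 < x ->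
  twice_derivable u x /\
  x * derive1n 2 u x + (b - x) * derive1 u x - a * u x = 0.

(* U(a, b, x) ~ x^(-a) as x -> +oo. *)
Definition is_tricomiU a b u :=
  kummer_eq a b u /\ x `^ a * u x @[x --> +oo] --> (1 : R).

Definition tricomiU a b : R -> R :=
  xget (fun=> 0) [set u | is_tricomiU a b u].

Definition whittakerW kappa mu x : R :=
  expR (- x / 2) * x `^ (mu + 2^-1) *
  tricomiU (2^-1 + mu - kappa) (1 + 2 * mu) x.

Definition modified_bessel_eq nu u := forall x, 0 < x ->
  twice_derivable u x /\
  x ^+ 2 * derive1n 2 u x + x * derive1 u x - (x ^+ 2 + nu ^+ 2) * u x = 0.

(* K_nu(x) ~ sqrt(pi / (2 x)) exp(-x) as x -> +oo. *)
Definition is_besselK nu u :=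
  modified_bessel_eq nu u /\
  Num.sqrt (2 * x / pi) * expR x * u x @[x --> +oo] --> (1 : R).

Definition besselK nu : R -> R :=
  xget (fun=> 0) [set u | is_besselK nu u].

End SpecialFunctions.

(* Main.v *)
(* Both functions are identified with the integral
     K(nu, x) = \int_0^oo exp (- x cosh t) cosh (nu t) dt.
   Differentiating twice under the integral sign and integrating an exact
   derivative in t shows that K(nu, .) solves the modified Bessel equation, and
   Laplace's method (dilation t = s sqrt (2 / x), dominated convergence and the
   Gauss integral) gives its behaviour at +oo. By Abel's formula a recessive
   solution is determined by its asymptotics, so besselK nu x = K(nu, x), and
   likewise tricomiU (1/2 + mu) (1 + 2 mu) x is
   pi^(-1/2) exp (x / 2) x^(-mu) K(mu, x / 2). Hence
   W_{0,mu}(x) = sqrt (x / pi) K(mu, x / 2) for every real mu; since K is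
   differentiable and even in nu, its derivative is odd, which accounts for the
   sign. *)

Require Import Defs.
From HB Require Import structures.
From mathcomp Require Import all_boot all_order all_algebra.
From mathcomp Require Import all_classical all_reals all_analysis.
From mathcomp Require Import measurable_realfun lebesgue_integral_under.
From mathcomp Require Import ring lra.

Import Order.TTheory GRing.Theory Num.Theory.
Import numFieldNormedType.Exports.

Local Open Scope classical_set_scope.
Local Open Scope ring_scope.

(** * Hyperbolic cosine and sine: derivatives, growth and elementary inequalities *)

Section hyperbolic.
Context {R : realType}.
Implicit Types t x : R.

Definition coshR t : R := (expR t + expR (- t)) / 2.
Definition sinhR t : R := (expR t - expR (- t)) / 2.

Lemma is_derive1_expR_comp (f : R -> R) x (df : R) :
  is_derive x 1 f df -> is_derive x 1 (fun t => expR (f t)) (df * expR (f x)).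
Proof.
move=> fdf; have := @is_derive1_comp R expR f x (expR (f x)) df.
by rewrite mulrC => H; apply: H; exact: is_derive_expR.
Qed.

Lemma is_derive_coshR t : is_derive t 1 coshR (sinhR t).
Proof.
rewrite /coshR /sinhR.
have h1 : is_derive t 1 (fun t => expR (- t)) (- 1 * expR (- t)).
  by apply: is_derive1_expR_comp.
by apply: is_derive_eq; rewrite /GRing.scale/=; field.
Qed.

Lemma is_derive_sinhR t : is_derive t 1 sinhR (coshR t).
Proof.
rewrite /coshR /sinhR.
have h1 : is_derive t 1 (fun t => expR (- t)) (- 1 * expR (- t)).
  by apply: is_derive1_expR_comp.
by apply: is_derive_eq; rewrite /GRing.scale/=; field.
Qed.

Lemma coshR_sqr t : coshR t ^+ 2 = 1 + sinhR t ^+ 2.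
Proof.
have := expRxMexpNx_1 t; rewrite /coshR /sinhR => h.
by apply/eqP; rewrite -subr_eq0; apply/eqP; field: h.
Qed.

Lemma coshRN t : coshR (- t) = coshR t.
Proof. by rewrite /coshR opprK addrC. Qed.

Lemma coshR_gt0 t : 0 < coshR t.
Proof. by rewrite divr_gt0 ?addr_gt0 ?expR_gt0. Qed.

Lemma coshR_ge t : expR t / 2 <= coshR t.
Proof. by rewrite ler_pM2r ?invr_gt0// lerDl expR_ge0. Qed.

Lemma coshR_le t : coshR t <= expR `|t|.
Proof.
rewrite ler_pdivrMr// mulr_natr mulr2n lerD// ler_expR ?ler_norm//.
by rewrite -normrN ler_norm.
Qed.

Lemma normr_sinhR_le t : `|sinhR t| <= expR `|t|.
Proof.
apply: le_trans (coshR_le t).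
rewrite /sinhR /coshR normrM (ger0_norm (_ : 0 <= 2^-1))//.
rewrite ler_pM2r// (le_trans (ler_normB _ _))//.
by rewrite !ger0_norm ?expR_ge0.
Qed.

Lemma coshR_continuous : continuous coshR.
Proof.
move=> t; apply/differentiable_continuous/derivable1_diffP.
by have [] := is_derive_coshR t.
Qed.

Lemma sinhR_continuous : continuous sinhR.
Proof.
move=> t; apply/differentiable_continuous/derivable1_diffP.
by have [] := is_derive_sinhR t.
Qed.

Lemma sinhR0 : sinhR 0 = 0.
Proof. by rewrite /sinhR oppr0 subrr mul0r. Qed.

Lemma coshR0 : coshR 0 = 1.
Proof. by rewrite /coshR oppr0 expR0; field. Qed.

(** Makes the exponent of Laplace's method, cosh minus its minimum, an exact square. *)
Lemma coshR_half t : coshR (2 * t) - 1 = 2 * sinhR t ^+ 2.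
Proof.
have := expRxMexpNx_1 t; rewrite /coshR /sinhR.
rewrite mulr_natl mulr2n opprD !expRD => h.
by apply/eqP; rewrite -subr_eq0; apply/eqP; field: h.
Qed.

(** By the mean value theorem, since cosh^2 = 1 + sinh^2 and cosh > 0 force the derivative cosh to
    be at least 1. It gives the Gaussian domination in Laplace's method. *)
Lemma le_sinhR t : 0 <= t -> t <= sinhR t.
Proof.
move=> t0; have [->|tn0] := eqVneq t 0; first by rewrite sinhR0.
have {}t0 : 0 < t by rewrite lt0r tn0.
have [s _] := @MVT R sinhR coshR 0 t t0 (fun x _ => is_derive_sinhR x)
  (continuous_subspaceT sinhR_continuous).
rewrite sinhR0 !subr0 => ->; rewrite ler_peMl ?(ltW t0)//.
have := coshR_sqr s; have := coshR_gt0 s; have := sqr_ge0 (sinhR s).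
by move=> h1 h2 h3; nra.
Qed.

End hyperbolic.

(** * Uniqueness of the recessive solution of a second-order linear equation *)

Section recessive.
Context {R : realType}.
Implicit Types (p q r u E : R -> R) (x : R).

Lemma is_derive0_eq_pos (f : R -> R) :
  (forall x, 0 < x -> is_derive x 1 f 0) ->
  forall x y, 0 < x -> 0 < y -> f x = f y.
Proof.
move=> f0; suff H x y : 0 < x -> x < y -> f x = f y.
  by move=> x y x0 y0; case: (ltgtP x y) => [xy|yx|->//]; [|symmetry]; exact: H.
move=> x0 xy.
have [||c _] := @MVT R f (cst 0) x y xy.
- by move=> z; rewrite in_itv/= => /andP[xz _]; apply: f0; rewrite (lt_trans x0).
- apply: derivable_within_continuous => z; rewrite in_itv/= => /andP[xz _].
  by have [] := f0 z (lt_le_trans x0 xz).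
by rewrite mul0r => /eqP; rewrite subr_eq0 => /eqP.
Qed.

(* Abel: E times the Wronskian of u0 and u is a constant C, so that
   (u / u0)' = C / (E * u0 ^ 2) stays away from 0 near +oo unless C = 0. *)
Lemma recessive_unique p q r E u0 u (M : R) :
  (forall x, 0 < x -> p x != 0) ->
  (forall x, 0 < x -> 0 < E x /\ is_derive x 1 E (q x / p x * E x)) ->
  (forall x, 0 < x -> 0 < u0 x) ->
  (forall x, 0 < x -> twice_derivable u0 x /\
     p x * derive1n 2 u0 x + q x * derive1 u0 x + r x * u0 x = 0) ->
  (forall x, 0 < x -> twice_derivable u x /\
     p x * derive1n 2 u x + q x * derive1 u x + r x * u x = 0) ->
  (\forall x \near +oo, E x * u0 x ^+ 2 <= M) ->
  u x / u0 x @[x --> +oo] --> (1 : R) ->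
  forall x, 0 < x -> u x = u0 x.
Proof.
move=> p0 hE u0_gt0 ode0 ode bdM uu0.
have u0_neq0 x : 0 < x -> u0 x != 0 by move=> /u0_gt0/lt0r_neq0.
have der (v : R -> R) x : twice_derivable v x ->
    is_derive x 1 v (derive1 v x) /\ is_derive x 1 (derive1 v) (derive1n 2 v x).
  move=> [d1 d2]; have := DeriveDef d1 erefl; have := DeriveDef d2 erefl.
  by rewrite -!derive1E -derive1n1 -derive1nS.
pose W x := E x * (u0 x * derive1 u x - derive1 u0 x * u x).
have W' x : 0 < x -> is_derive x 1 W 0.
  move=> x0; have [tu0 e0] := ode0 x x0; have [tu e1] := ode x x0.
  have [? dE] := hE x x0.
  move: (der _ _ tu0) (der _ _ tu) e0 e1; rewrite /W.
  move: (derive1n 2 u x) (derive1n 2 u0 x) (derive1 u) (derive1 u0).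
  move=> c c0 b b0 [a1 a2] [b1 b2] e0 e1.
  apply: is_derive_eq; rewrite /GRing.scale/=.
  have px0 := p0 x x0.
  (* Multiplied by [p], the derivative of [W] is [E] times a combination of the two equations: [u0]
     times that of [u] minus [u] times that of [u0]. *)
  apply: (mulfI px0); rewrite mulr0.
  transitivity (E x * (u0 x * (p x * c + q x * b x + r x * u x)
    - u x * (p x * c0 + q x * b0 x + r x * u0 x))); last by rewrite e0 e1; ring.
  by field.
have [C WC] : exists C, forall x, 0 < x -> W x = C.
  exists (W 1) => x x0.
  exact: is_derive0_eq_pos W' _ _ x0 ltr01.
pose w x := u x / u0 x.
have w' x : 0 < x -> is_derive x 1 w (C / (E x * u0 x ^+ 2)).
  move=> x0; have [tu0 _] := ode0 x x0; have [tu _] := ode x x0.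
  have [/lt0r_neq0 E0 _] := hE x x0.
  have [a1 _] := der _ _ tu0; have [b1 _] := der _ _ tu.
  have u0x := u0_neq0 x x0.
  have := is_deriveV (f := u0) u0x a1 => d.
  rewrite /w; apply: is_derive_eq; rewrite /GRing.scale/= -(WC x x0) /W.
  by field; rewrite u0x.
have C0 : C = 0.
  apply/eqP/negPn/negP => C0.
  have M0 : 0 < M.
    near (pinfty_nbhs R) => x.
    have x0 : 0 < x by near: x; exact: nbhs_pinfty_gt.
    have : E x * u0 x ^+ 2 <= M by near: x.
    apply: lt_le_trans; have [? _] := hE x x0.
    by rewrite mulr_gt0// exprn_gt0// u0_gt0.
  (* Far out, |w'| is at least |C| / M = 2 e, so [w] changes by at least 2 e over a unit interval,
     although both end values lie within e of the limit 1. *)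
  pose e := `|C| / M / 2.
  have e0 : 0 < e by rewrite !divr_gt0// normr_gt0.
  move/cvgrPdist_lt : (uu0) => /(_ _ e0) [X [Xr HX]].
  case: bdM => Y [Yr HY].
  (* Beyond [Z] the argument is positive, [w] is e-close to 1 and the bound [M] holds; the mean
     value theorem is applied on [Z + 1, Z + 2]. *)
  pose Z := Num.max 0 (Num.max X Y).
  have ZX x : Z < x -> [/\ 0 < x, X < x & Y < x].
    by rewrite /Z !gt_max => /and3P[].
  have z1 : Z < Z + 1 by rewrite ltrDl.
  have z2 : Z + 1 < Z + 2 by rewrite ltrD2l ltr1n.
  have Zp x : Z + 1 <= x -> 0 < x.
    by move=> /(lt_le_trans z1)/ZX[].
  have [||c] := @MVT R w (fun x => C / (E x * u0 x ^+ 2)) _ _ z2.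
  - move=> z; rewrite in_itv/= => /andP[/ltW z0 _]; apply: w'.
    exact: Zp.
  - apply: derivable_within_continuous => z; rewrite in_itv/= => /andP[z0 _].
    by have [] := w' z (Zp _ z0).
  rewrite in_itv/= => /andP[cz _].
  have [c0 _ cY] := ZX c (lt_trans z1 cz).
  have [_ Xz1 _] := ZX _ z1; have [_ Xz2 _] := ZX _ (lt_trans z1 z2).
  have -> : Z + 2 - (Z + 1) = 1 :> R by ring.
  rewrite mulr1 => wE.
  have h1 := HX _ Xz1; have h2 := HX _ Xz2.
  have Eu : 0 < E c * u0 c ^+ 2.
    by have [? _] := hE c c0; rewrite mulr_gt0// exprn_gt0// u0_gt0.
  have : `|C| / M <= `|w (Z + 2) - w (Z + 1)|.
    rewrite wE normrM normfV (gtr0_norm Eu) ler_pM2l ?normr_gt0// lef_pV2//.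
    exact: HY.
  apply/negP; rewrite -ltNge.
  have -> : w (Z + 2) - w (Z + 1) = (1 - w (Z + 1)) - (1 - w (Z + 2)) by ring.
  rewrite (le_lt_trans (ler_normB _ _))//.
  have -> : `|C| / M = e + e by rewrite /e; field; exact: lt0r_neq0.
  exact: ltrD.
have wcst x : 0 < x -> w x = w 1.
  have w'0 (z : R) : 0 < z -> is_derive z 1 w 0.
    by move=> z_gt0; have := w' z z_gt0; rewrite C0 mul0r.
  by move=> x0; exact: is_derive0_eq_pos w'0 _ _ x0 ltr01.
have w1 : w 1 = 1.
  apply: (cvg_unique (@Rhausdorff R) _ uu0).
  by apply: cvg_near_cst; near=> x; exact: wcst.
move=> x x0; have := wcst x x0; rewrite w1 /w => /(canRL (divfK (u0_neq0 x x0))).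
by rewrite mul1r.
Unshelve. all: by end_near. Qed.

End recessive.

(** * Integrals of exp (- x cosh t) g(t) over the half-line *)

Section laplace_cosh.
Context {R : realType}.
Implicit Types (g : R -> R) (x nu t z : R).
Let mu : {measure set _ -> \bar R} := @lebesgue_measure R.

(** A class closed under sums and products whose members are integrable against the kernel. The rate
    is a natural number so that one term of the exponential series beats it. *)
Definition exp_growth g := continuous g /\
  exists C : R, exists n : nat, forall t, 0 <= t -> `|g t| <= C * expR (n%:R * t).

Lemma exp_growthM g h : exp_growth g -> exp_growth h ->
  exp_growth (fun t => g t * h t).
Proof.
move=> [cg [C [n gC]]] [ch [D [m hD]]]; split.
  by move=> t; apply: continuousM; [exact: cg|exact: ch].
exists (C * D), (n + m)%N => t t0; rewrite normrM natrD mulrDl expRD mulrACA.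
by rewrite ler_pM// ?gC ?hD.
Qed.

Lemma exp_growthD g h : exp_growth g -> exp_growth h ->
  exp_growth (fun t => g t + h t).
Proof.
move=> [cg [C [n gC]]] [ch [D [m hD]]]; split.
  by move=> t; apply: continuousD; [exact: cg|exact: ch].
(* The bound at t = 0 gives the sign of [C], which allows the rate [n] to be raised to [n + m]. *)
have C0 : 0 <= C.
  by have := gC 0 (lexx _); rewrite mulr0 expR0 mulr1; exact: le_trans.
have D0 : 0 <= D.
  by have := hD 0 (lexx _); rewrite mulr0 expR0 mulr1; exact: le_trans.
exists (C + D), (n + m)%N => t t0; rewrite (le_trans (ler_normD _ _))// mulrDl.
rewrite lerD// ?(le_trans (gC t t0)) ?(le_trans (hD t t0))//.
  by rewrite ler_wpM2l// ler_expR ler_wpM2r// ler_nat leq_addr.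
by rewrite ler_wpM2l// ler_expR ler_wpM2r// ler_nat leq_addl.
Qed.

Lemma exp_growth_cst x : exp_growth (fun=> x).
Proof.
split; first by move=> t; exact: cvg_cst.
by exists `|x|, 0%N => t t0; rewrite mul0r expR0 mulr1.
Qed.

Lemma exp_growth_id : exp_growth id.
Proof.
split; first by move=> t; exact: cvg_id.
exists 1, 1%N => t t0; rewrite !mul1r ger0_norm//.
by rewrite (le_trans _ (expR_ge1Dx t))// lerDr.
Qed.

(** Rounds the rate |nu| up to a natural number, as [exp_growth] requires. *)
Let expR_normM nu t : 0 <= t ->
    expR `|nu * t| <= 1 * expR ((Num.truncn `|nu|).+1%:R * t).
Proof.
move=> t0; rewrite mul1r ler_expR normrM (ger0_norm t0) ler_wpM2r//.
by rewrite ltW// truncnS_gt.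
Qed.

Lemma exp_growth_coshR nu : exp_growth (fun t => coshR (nu * t)).
Proof.
split.
  move=> t; apply: (@continuous_comp _ _ _ ( *%R nu) coshR).
    exact: mulrl_continuous.
  exact: coshR_continuous.
exists 1, (Num.truncn `|nu|).+1 => t t0.
rewrite gtr0_norm ?coshR_gt0// (le_trans (coshR_le _))//.
exact: expR_normM.
Qed.

Lemma exp_growth_sinhR nu : exp_growth (fun t => sinhR (nu * t)).
Proof.
split.
  move=> t; apply: (@continuous_comp _ _ _ ( *%R nu) sinhR).
    exact: mulrl_continuous.
  exact: sinhR_continuous.
exists 1, (Num.truncn `|nu|).+1 => t t0.
by rewrite (le_trans (normr_sinhR_le _))//; exact: expR_normM.
Qed.

Definition lapker x t := expR (- (x * coshR t)).

Lemma lapker_continuous x : continuous (lapker x).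
Proof.
move=> t; apply: (@continuous_comp _ _ _ (fun t => - (x * coshR t)) expR).
  apply: continuousN; apply: continuousM; first exact: cvg_cst.
  exact: coshR_continuous.
exact: continuous_expR.
Qed.

(* [s ^+ n.+1 / n.+1`! <= expR s] at s = x * expR t / 2. *)
Lemma lapker_decay x (n : nat) : 0 < x ->
  exists2 M, 0 <= M & forall t, lapker x t * expR (n%:R * t) <= M * expR (- t).
Proof.
(* One power more than [n] is spent: exp ((n + 1) t) in the denominator absorbs exp (n t) and leaves
   exp (- t). *)
move=> x0; exists ((n.+1)`!%:R * (2 / x) ^+ n.+1) => [|t].
  by rewrite mulr_ge0// exprn_ge0// divr_ge0// ltW.
set s := x * (expR t / 2).
have s0 : 0 < s by rewrite mulr_gt0// divr_gt0// expR_gt0.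
have sn : 0 < s ^+ n.+1 by rewrite exprn_gt0.
have h : lapker x t <= (n.+1)`!%:R / s ^+ n.+1.
  rewrite (@le_trans _ _ (expR (- s)))//.
    by rewrite ler_expR lerN2 ler_pM2l// coshR_ge.
  rewrite expRN -[leRHS]invrK lef_pV2 ?posrE ?invr_gt0 ?expR_gt0//; last first.
    by rewrite divr_gt0// ltr0n fact_gt0.
  rewrite invf_div (le_trans _ (expR_ge1Dxn n (ltW s0)))// lerDr//.
rewrite (le_trans (ler_wpM2r (expR_ge0 _) h))//.
rewrite expRM_natl /s !exprMn !exprVn expRN (exprS (expR t)) le_eqVlt.
apply/orP; left; apply/eqP; field.
by rewrite ?(expf_neq0, lt0r_neq0, expR_gt0).
Qed.

Lemma Rintegral_expRN : mu.-integrable `[0, +oo[ (fun t => (expR (- t))%:E) /\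
  \int[mu]_(t in `[0, +oo[) expR (- t) = 1.
Proof.
have cN : continuous (fun t => expR (- t) : R).
  move=> t; apply: (@continuous_comp _ _ _ -%R expR).
    exact: continuousN.
  exact: continuous_expR.
have d t : is_derive t 1 (fun t => - expR (- t) : R) (expR (- t)).
  have : is_derive t 1 (fun t => expR (- t)) (- 1 * expR (- t)).
    by apply: is_derive1_expR_comp.
  by move=> h; apply: is_derive_eq; rewrite mulN1r opprK.
have I : (\int[mu]_(t in `[0%R, +oo[) (expR (- t))%:E = 1)%E.
  rewrite (@ge0_continuous_FTC2y _ _ (fun t => - expR (- t)) _ 0)//.
  - by rewrite oppr0 expR0 EFinN oppeK add0e.
  - exact: continuous_subspaceT.
  - by rewrite -[X in _ --> X]oppr0; apply: cvgN; exact: cvgr_expR.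
  - by apply/cvg_at_right_filter; apply: cvgN; exact: cN.
  - by move=> t _; rewrite derive1E derive_val.
split; last by rewrite /Rintegral I.
apply/integrableP; split.
  by apply/measurable_EFinP/measurable_funTS; exact: continuous_measurable_fun.
under eq_integral do rewrite /= ger0_norm ?expR_ge0//.
by rewrite I ltry.
Qed.

(** Supplies the dominating function M exp (- t) for the integrability and differentiation results
    below. *)
Lemma lapker_expgrowth_decay x g : 0 < x -> exp_growth g ->
  exists2 M, 0 <= M & forall t, 0 <= t -> `|lapker x t * g t| <= M * expR (- t).
Proof.
move=> x0 [cg [C [n gC]]].
have [M M0 hM] := lapker_decay x n x0.
have C0 : 0 <= C.
  by have := gC 0 (lexx _); rewrite mulr0 expR0 mulr1; exact: le_trans.
exists (C * M) => [|t t0]; first exact: mulr_ge0.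
rewrite normrM (ger0_norm (expR_ge0 _)).
rewrite (le_trans (ler_wpM2l (expR_ge0 _) (gC t t0)))// mulrCA -mulrA.
by rewrite ler_wpM2l//; exact: hM.
Qed.

Lemma continuous_dominated_integrable (f h : R -> R) : continuous f ->
  mu.-integrable `[0, +oo[ (EFin \o h) ->
  (forall t, 0 <= t -> `|f t| <= h t) ->
  mu.-integrable `[0, +oo[ (EFin \o f).
Proof.
move=> cf ih fh; apply: le_integrable ih => //.
  by apply/measurable_EFinP/measurable_funTS; exact: continuous_measurable_fun.
move=> t; rewrite /= in_itv/= andbT => t0.
by rewrite lee_fin (le_trans (fh t t0))// ler_norm.
Qed.

Lemma integrable_MexpRN M : mu.-integrable `[0, +oo[ (EFin \o (fun t => M * expR (- t))).
Proof.
have [h _] := Rintegral_expRN.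
by apply: (eq_integrable _ _ _ _ (integrableZl _ M h)).
Qed.

Lemma lapker_integrable x g : 0 < x -> exp_growth g ->
  mu.-integrable `[0, +oo[ (EFin \o (fun t => lapker x t * g t)).
Proof.
move=> x0 gg; have [M M0 hM] := lapker_expgrowth_decay x g x0 gg.
apply: continuous_dominated_integrable (integrable_MexpRN M) hM => t.
apply: continuousM; first exact: lapker_continuous.
by have [cg _] := gg; exact: cg.
Qed.

Definition lapcosh x g := \int[mu]_(t in `[0, +oo[) (lapker x t * g t).

(** Differentiation under the integral sign on ]x / 2, x + 1[. The kernel decreases in its
    parameter, so the bound at x / 2 serves the whole interval. *)
Lemma is_derive_lapcosh x g : 0 < x -> exp_growth g ->
  is_derive x 1 (lapcosh ^~ g) (lapcosh x (fun t => - coshR t * g t)).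
Proof.
move=> x0 gg.
have gcg : exp_growth (fun t => coshR t * g t).
  apply: exp_growthM => //; have := exp_growth_coshR 1.
  by under eq_fun do rewrite mul1r.
have x20 : 0 < x / 2 by rewrite divr_gt0.
have d t z : is_derive z 1 (fun x => lapker x t * g t)
    (lapker z t * (- coshR t * g t)).
  have : is_derive z 1 (fun x => lapker x t) (- coshR t * lapker z t).
    apply: is_derive1_expR_comp.
    by apply: is_derive_eq; rewrite /GRing.scale/=; ring.
  by move=> ?; apply: is_derive_eq; rewrite /GRing.scale/=; ring.
have [M M0 hM] := lapker_expgrowth_decay _ _ x20 gcg.
have Ix : [set` `](x / 2), (x + 1)[] x.
  by rewrite /= in_itv/= ltr_pdivrMr// ltr_pMr// ltr1n ltrDl ltr01.
have Ipos z : [set` `](x / 2), (x + 1)[] z -> x / 2 < z.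
  by rewrite /= in_itv/= => /andP[].
have i1 z : [set` `](x / 2), (x + 1)[] z ->
    mu.-integrable `[0, +oo[ (EFin \o (fun t => lapker z t * g t)).
  by move=> /Ipos z0; apply: lapker_integrable => //; exact: lt_trans z0.
have i2 z t : [set` `](x / 2), (x + 1)[] z -> [set` `[0, +oo[] t ->
    derivable (fun x => lapker x t * g t) z 1.
  by move=> _ _; have [] := d t z.
have pE z t : partial1of2 (fun x t => lapker x t * g t) z t =
    lapker z t * (- coshR t * g t).
  by rewrite partial1of2E derive_val.
have i4 z t : [set` `](x / 2), (x + 1)[] z -> [set` `[0, +oo[] t ->
    `|partial1of2 (fun x t => lapker x t * g t) z t| <= M * expR (- t).
  move=> /Ipos z0; rewrite /= in_itv/= andbT => t0; rewrite pE.
  rewrite (le_trans _ (hM t t0))// mulNr mulrN normrN !(normrM (lapker _ _)).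
  apply: ler_wpM2r; first exact: normr_ge0.
  rewrite !ger0_norm ?expR_ge0// ler_expR lerN2 ler_pM2r ?coshR_gt0//.
  exact: ltW.
have i3 t : 0 <= M * expR (- t) by rewrite mulr_ge0 ?expR_ge0.
apply: DeriveDef.
  exact: (@derivable_under_integral _ _ _ mu _ _ (measurable_itv _) _ _ _ Ix i1 i2
    _ i3 (integrable_MexpRN M) i4).
rewrite -derive1E.
rewrite (@differentiation_under_integral _ _ _ mu _ _ (measurable_itv _) _ _ _ Ix i1 i2
    _ i3 (integrable_MexpRN M) i4).
by apply: eq_Rintegral => t _; exact: pE.
Qed.

End laplace_cosh.

(** * The integral representation of K: Bessel equation and smoothness in the order *)

Section bessel_integral.
Context {R : realType}.
Implicit Types (g h : R -> R) (x nu t z : R).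
Let mu : {measure set _ -> \bar R} := @lebesgue_measure R.

Lemma exp_growth_cosh : exp_growth (@coshR R).
Proof.
by have := exp_growth_coshR (1 : R); under eq_fun do rewrite mul1r.
Qed.

Lemma exp_growth_sinh : exp_growth (@sinhR R).
Proof.
by have := exp_growth_sinhR (1 : R); under eq_fun do rewrite mul1r.
Qed.

Lemma exp_growthN_cosh : exp_growth (fun t => - @coshR R t).
Proof.
under eq_fun do rewrite -mulN1r.
apply: (exp_growthM (fun=> -1) coshR); first exact: exp_growth_cst.
exact: exp_growth_cosh.
Qed.

Lemma eq_lapcosh x g h : g =1 h -> lapcosh x g = lapcosh x h.
Proof. by move=> gh; apply: eq_Rintegral => t _; rewrite gh. Qed.

Lemma lapcoshZ x a g : 0 < x -> exp_growth g ->
  lapcosh x (fun t => a * g t) = a * lapcosh x g.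
Proof.
move=> x0 gg; rewrite /lapcosh -RintegralZl//; last exact: lapker_integrable.
by apply: eq_Rintegral => t _; rewrite mulrCA.
Qed.

Lemma lapcoshD x g h : 0 < x -> exp_growth g -> exp_growth h ->
  lapcosh x (fun t => g t + h t) = lapcosh x g + lapcosh x h.
Proof.
move=> x0 gg gh; rewrite /lapcosh -RintegralD//; last 2 first.
- exact: lapker_integrable.
- exact: lapker_integrable.
by apply: eq_Rintegral => t _; rewrite mulrDr.
Qed.

Ltac solve_exp_growth := repeat
  lazymatch goal with
  | |- exp_growth (fun _ => ?c) => exact: exp_growth_cst
  | |- exp_growth (fun t => t) => exact: exp_growth_id
  | |- exp_growth (fun t => @?g t * @?h t) => apply: (exp_growthM g h)
  | |- exp_growth (fun t => @?g t + @?h t) => apply: (exp_growthD g h)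
  | |- exp_growth (fun t => coshR (_ * t)) => exact: exp_growth_coshR
  | |- exp_growth (fun t => sinhR (_ * t)) => exact: exp_growth_sinhR
  | |- exp_growth (fun t => coshR t) => exact: exp_growth_cosh
  | |- exp_growth (fun t => sinhR t) => exact: exp_growth_sinh
  | |- exp_growth (fun t => - coshR t) => exact: exp_growthN_cosh
  | |- exp_growth _ => assumption
  end.

(* The fundamental theorem of calculus on [0, +oo[ is only available for
   nonnegative integrands, whence the shift by M * expR (- t). *)
Lemma lapcosh_exact x g (dg : R -> R) : 0 < x -> exp_growth g -> exp_growth dg ->
  (forall t, is_derive t 1 g (dg t)) ->
  lapcosh x (fun t => dg t - x * sinhR t * g t) = - (lapker x 0 * g 0).
Proof.
move=> x0 gg gdg dgE.
set f := fun t => dg t - x * sinhR t * g t.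
have gf : exp_growth f.
  by rewrite /f; under eq_fun do rewrite -mulN1r; solve_exp_growth.
have [M M0 hM] := lapker_expgrowth_decay _ _ x0 gf.
have [N N0 hN] := lapker_expgrowth_decay _ _ x0 gg.
have expN0 : expR (- t) @[t --> +oo] --> (0 : R) := @cvgr_expR R.
have eN t : is_derive t 1 (fun t => expR (- t)) (- 1 * expR (- t)).
  by apply: is_derive1_expR_comp.
pose F t := lapker x t * g t - M * expR (- t).
have dF t : is_derive t 1 F
    (lapker x t * f t + M * expR (- t)).
  have : is_derive t 1 (lapker x) (- (x * sinhR t) * lapker x t).
    apply: is_derive1_expR_comp.
    have := is_derive_coshR t => ?.
    by apply: is_derive_eq; rewrite /GRing.scale/=; ring.
  move=> ?; have ? := dgE t; rewrite /F.
  by apply: is_derive_eq; rewrite /GRing.scale/= /f; ring.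
have cF : continuous F.
  move=> t; apply/differentiable_continuous/derivable1_diffP.
  by have [] := dF t.
have cker : continuous (fun t => lapker x t * f t + M * expR (- t)).
  move=> t; apply: cvgD.
    apply: cvgM; first exact: lapker_continuous.
    by have [cf _] := gf; exact: cf.
  apply: cvgM; first exact: cvg_cst.
  apply: (@continuous_comp _ _ _ -%R expR).
    exact: continuousN.
  exact: continuous_expR.
have := @Rintegral_ge0_continuous_FTC2y _
  (fun t => lapker x t * f t + M * expR (- t))
  F 0 0.
rewrite RintegralD//; last 2 first.
- exact: lapker_integrable.
- exact: integrable_MexpRN.
have [ie e1] := @Rintegral_expRN R.
have F0 : F 0 = lapker x 0 * g 0 - M by rewrite /F oppr0 expR0 mulr1.
rewrite RintegralZl// e1 mulr1 sub0r F0 opprB => H.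
(* Since exp (- t) has integral 1, the shift adds [M] to both sides and cancels. *)
apply: (addIr M); rewrite -/(lapcosh x f) addrC [RHS]addrC; rewrite addrC H//.
- move=> t t0; rewrite -lerBlDr sub0r.
  by have := hM t t0; rewrite ler_norml => /andP[].
- exact: continuous_subspaceT.
- rewrite /F -(subr0 0); apply: cvgB; last first.
    by rewrite -(mulr0 M); apply: cvgM => //; exact: cvg_cst.
  apply: norm_cvg0.
  apply: (@squeeze_cvgr _ _ _ _ (cst 0) (fun t => N * expR (- t))).
  + near=> t; apply/andP; split; first exact: normr_ge0.
    by apply: hN; near: t; exact: nbhs_pinfty_ge.
  + exact: cvg_cst.
  + by rewrite -(mulr0 N); apply: cvgM => //; exact: cvg_cst.
- by rewrite -F0; apply: cvg_at_right_filter; exact: cF.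
- by move=> t _; rewrite derive1E; have [_ ->] := dF t.
Unshelve. all: by end_near. Qed.

(** The classical integral for the Macdonald function, from which evenness and differentiability in
    [nu] can be read off. *)
Definition besselKI nu x := lapcosh x (fun t => coshR (nu * t)).

Lemma besselKIN nu x : besselKI (- nu) x = besselKI nu x.
Proof. by apply: eq_lapcosh => t; rewrite mulNr coshRN. Qed.

(** The x-derivatives of [besselKI]: each one brings down a factor - cosh t, and [besselKI2] keeps
    the nested form that [is_derive_lapcosh] produces. *)
Definition besselKI1 nu x := lapcosh x (fun t => - coshR t * coshR (nu * t)).

Definition besselKI2 nu x :=
  lapcosh x (fun t => - coshR t * (- coshR t * coshR (nu * t))).

Lemma is_derive_besselKI nu x : 0 < x -> is_derive x 1 (besselKI nu) (besselKI1 nu x).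
Proof. by move=> x0; apply: is_derive_lapcosh => //; exact: exp_growth_coshR. Qed.

Lemma is_derive_besselKI1 nu x : 0 < x ->
  is_derive x 1 (besselKI1 nu) (besselKI2 nu x).
Proof.
move=> x0; apply: is_derive_lapcosh => //.
by solve_exp_growth.
Qed.

(* The modified Bessel operator maps the integrand to the t-derivative of
   expR (- (x * coshR t)) *
   (- (x * sinhR t * coshR (nu * t)) - nu * sinhR (nu * t)). *)
Lemma besselKI_eq nu x : 0 < x ->
  x ^+ 2 * besselKI2 nu x + x * besselKI1 nu x
    - (x ^+ 2 + nu ^+ 2) * besselKI nu x = 0.
Proof.
move=> x0; have gc := exp_growth_coshR nu; have gs := exp_growth_sinhR nu.
rewrite /besselKI /besselKI1 /besselKI2 -mulNr -!lapcoshZ//; try by solve_exp_growth.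
rewrite -!lapcoshD//; try by solve_exp_growth.
set h := fun t => - x * sinhR t * coshR (nu * t) + - nu * sinhR (nu * t).
set h' := fun t => - x * coshR t * coshR (nu * t)
  + (- x * nu) * (sinhR t * sinhR (nu * t)) + - nu ^+ 2 * coshR (nu * t).
have gh : exp_growth h.
  by rewrite /h; solve_exp_growth.
have gh' : exp_growth h'.
  by rewrite /h'; solve_exp_growth.
have dh t : is_derive t 1 h (h' t).
  have d1 : is_derive t 1 (fun t => coshR (nu * t)) (nu * sinhR (nu * t)).
    have d : is_derive t 1 ( *%R nu) nu.
      by apply: is_derive_eq; rewrite /GRing.scale/=; ring.
    by rewrite mulrC; have := is_derive1_comp (is_derive_coshR (nu * t)) d.
  have d2 : is_derive t 1 (fun t => sinhR (nu * t)) (nu * coshR (nu * t)).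
    have d : is_derive t 1 ( *%R nu) nu.
      by apply: is_derive_eq; rewrite /GRing.scale/=; ring.
    by rewrite mulrC; have := is_derive1_comp (is_derive_sinhR (nu * t)) d.
  have d3 := is_derive_sinhR t.
  by apply: is_derive_eq; rewrite /GRing.scale/= /h'; ring.
have := lapcosh_exact _ _ _ x0 gh gh' dh.
(* The boundary term vanishes, as both summands of [h] contain a sinh that is 0 at t = 0. *)
rewrite {2}/h mulr0 sinhR0 !(mulr0, mul0r) addr0 mulr0 oppr0 => <-.
apply: eq_lapcosh => t; rewrite /h /h'.
(* Turns x^2 cosh^2 - x^2 from the Bessel operator into the x^2 sinh^2 of the exact derivative. *)
have c2 : coshR t * coshR t = 1 + sinhR t ^+ 2 by rewrite -coshR_sqr expr2.
ring: c2.
Qed.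

Lemma derivable_besselKI x nu : 0 < x -> derivable (besselKI ^~ x) nu 1.
Proof.
(* [c] bounds |z| for every order z in ]nu - 1, nu + 1[; then |sinh (z t)| <= exp (c t) <= 2 cosh (c
   t) dominates the derivative in the order. *)
move=> x0; set c := `|nu| + 1.
have gG : exp_growth (fun t => t * (2 * coshR (c * t))).
  by solve_exp_growth.
have d t z : is_derive z 1 (fun z => lapker x t * coshR (z * t))
    (lapker x t * (t * sinhR (z * t))).
  have d : is_derive z 1 ( *%R^~ t) t.
    by apply: is_derive_eq; rewrite /GRing.scale/=; ring.
  have := @is_derive1_comp _ coshR ( *%R^~ t) _ _ _ (is_derive_coshR (z * t)) d.
  rewrite mulrC => ?.
  by apply: is_derive_eq; rewrite /GRing.scale/=; ring.
have Inu : [set` `](nu - 1), (nu + 1)[] nu.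
  by rewrite /= in_itv/= ltrDl ltr01 gtrBl ltr01.
have i1 z : [set` `](nu - 1), (nu + 1)[] z ->
    mu.-integrable `[0, +oo[ (EFin \o (fun t => lapker x t * coshR (z * t))).
  by move=> _; apply: lapker_integrable => //; exact: exp_growth_coshR.
have i2 z t : [set` `](nu - 1), (nu + 1)[] z -> [set` `[0, +oo[] t ->
    derivable (fun z => lapker x t * coshR (z * t)) z 1.
  by move=> _ _; have [] := d t z.
have i4 z t : [set` `](nu - 1), (nu + 1)[] z -> [set` `[0, +oo[] t ->
    `|partial1of2 (fun z t => lapker x t * coshR (z * t)) z t| <=
    `|lapker x t * (t * (2 * coshR (c * t)))|.
  rewrite /= !in_itv/= andbT => /andP[z1 z2] t0.
  rewrite partial1of2E derive_val 2!(normrM (lapker _ _)) ler_wpM2l//.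
  rewrite 2!(normrM t) ler_wpM2l// (normrM 2) (normr_nat R 2).
  rewrite (le_trans (normr_sinhR_le _))// gtr0_norm ?coshR_gt0//.
  rewrite -ler_pdivrMl// mulrC (le_trans _ (coshR_ge _))// ler_pM2r//.
  rewrite ler_expR normrM (ger0_norm t0) ler_wpM2r// /c.
  have := ler_norm nu; have := ler_norm (- nu); rewrite normrN => ? ?.
  by rewrite ler_norml; lra.
have i3 t : 0 <= `|lapker x t * (t * (2 * coshR (c * t)))| by [].
have iG : mu.-integrable `[0, +oo[
    (EFin \o (fun t => `|lapker x t * (t * (2 * coshR (c * t)))|)).
  have := integrable_norm (lapker_integrable _ _ x0 gG).
  exact.
exact: (@derivable_under_integral _ _ _ mu _ _ (measurable_itv _) _ _ _ Inu i1 i2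
    _ i3 iG i4).
Qed.

End bessel_integral.

(** * Laplace's method for the behaviour at infinity, and positivity *)

Section bessel_asymptotics.
Context {R : realType}.
Implicit Types (x nu t s y : R).
Let mu : {measure set _ -> \bar R} := @lebesgue_measure R.

(** The integrand of [besselKI] after the dilation t = y s, freed of the factor exp (- x); it tends
    to exp (- s^2) as y tends to 0. *)
Definition gausskern nu y s :=
  gauss_fun (2 / y * sinhR (y / 2 * s)) * coshR (nu * y * s).

(* The substitution t = y * s with x = 2 / y ^+ 2, for which
   x * (coshR t - 1) = (2 * sinhR (y * s / 2) / y) ^+ 2. *)
Lemma lapker_gausskern nu y s : 0 < y ->
  lapker (2 / y ^+ 2) (y * s) * coshR (nu * (y * s)) =
  expR (- (2 / y ^+ 2)) * gausskern nu y s.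
Proof.
move=> y0; have yn0 : y != 0 by exact: lt0r_neq0.
rewrite (mulrA nu).
rewrite /gausskern [RHS]mulrA; congr (_ * _).
rewrite /lapker /gauss_fun -expRD; congr expR.
have -> : coshR (y * s) = 1 + 2 * sinhR (y / 2 * s) ^+ 2.
  rewrite -coshR_half addrC subrK; congr coshR.
  by field.
by field.
Qed.

Lemma gausskern_continuous nu y : continuous (gausskern nu y).
Proof.
have [cs _] := exp_growthM _ _ (exp_growth_cst (2 / y)) (exp_growth_sinhR (y / 2)).
have [cc _] := exp_growth_coshR (nu * y).
move=> s; apply: (@continuousM _ _
  (gauss_fun \o (fun s => 2 / y * sinhR (y / 2 * s))) (fun s => coshR (nu * y * s))).
  by apply: continuous_comp; [exact: cs|exact: continuous_gauss_fun].
exact: cc.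
Qed.

(** Uniform in [y]: sinh u >= u bounds the Gaussian factor by exp (- s^2), the cosh is at most exp
    (|nu| s), and completing the square in |nu| s - s^2 + s yields the constant. *)
Lemma gausskern_bound nu y s : 0 < y -> y <= 1 -> 0 <= s ->
  `|gausskern nu y s| <= expR ((`|nu| + 1) ^+ 2 / 4) * expR (- s).
Proof.
move=> y0 y1 s0; rewrite /gausskern normrM.
rewrite (ger0_norm (gauss_fun_ge0 _)) (gtr0_norm (coshR_gt0 _)).
apply: (@le_trans _ _ (expR (- s ^+ 2) * expR (`|nu| * s))).
  apply: ler_pM; [exact: gauss_fun_ge0|exact: ltW (coshR_gt0 _)| |].
    rewrite /gauss_fun ler_expR lerN2.
    have h : s <= 2 / y * sinhR (y / 2 * s).
      rewrite -ler_pdivrMl ?divr_gt0// invf_div.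
      by apply: le_sinhR; rewrite mulr_ge0// divr_ge0// ltW.
    by rewrite lerXn2r// nnegrE (le_trans s0 h).
  rewrite (le_trans (coshR_le _))// ler_expR !normrM (gtr0_norm y0) (ger0_norm s0).
  by rewrite ler_wpM2r// ler_piMr.
rewrite -!expRD ler_expR.
have := sqr_ge0 (s - (`|nu| + 1) / 2).
have -> : (s - (`|nu| + 1) / 2) ^+ 2 =
  s ^+ 2 - (`|nu| + 1) * s + (`|nu| + 1) ^+ 2 / 4 by field.
by lra.
Qed.

Lemma gausskern_integrable nu y : 0 < y -> y <= 1 ->
  mu.-integrable `[0, +oo[ (EFin \o gausskern nu y).
Proof.
move=> y0 y1.
apply: (continuous_dominated_integrable _ _ (gausskern_continuous nu y)
  (integrable_MexpRN (expR ((`|nu| + 1) ^+ 2 / 4)))).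
by move=> s s0; exact: gausskern_bound.
Qed.

Lemma besselKI_gausskern nu y : 0 < y -> y <= 1 ->
  besselKI nu (2 / y ^+ 2) = expR (- (2 / y ^+ 2)) * y *
    \int[mu]_(s in `[0, +oo[) gausskern nu y s.
Proof.
move=> y0 y1; set x := 2 / y ^+ 2.
have dM : ( *%R y)^`()%classic = cst y.
  apply/funext => s; rewrite derive1E.
  have d : is_derive s 1 ( *%R y) y.
    by apply: is_derive_eq; rewrite /GRing.scale/=; ring.
  by rewrite derive_val.
rewrite -RintegralZl//; last exact: gausskern_integrable.
rewrite /besselKI /lapcosh /Rintegral; congr fine.
have := @increasing_ge0_integration_by_substitutiony R ( *%R y)
  (fun t => lapker x t * coshR (nu * t)) 0.
rewrite mulr0 dM => -> //.
- apply: eq_integral => s _ /=; congr EFin.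
  rewrite [RHS]mulrAC.
  exact: (congr1 ( *%R^~ y) (lapker_gausskern nu y s y0)).
- by move=> a b _ _ ab; rewrite ltr_pM2l.
- by move=> s _; exact: cvg_cst.
- exact: is_cvg_cst.
- exact: is_cvg_cst.
- split; first by move=> s _; exact: derivableM.
  apply: cvg_at_right_filter; exact: mulrl_continuous.
- exact: gt0_cvgMry.
- apply: continuous_subspaceT => t; apply: continuousM.
    exact: lapker_continuous.
  by have [c _] := exp_growth_coshR nu; exact: c.
- by move=> t _; rewrite mulr_ge0// ?expR_ge0// ltW// coshR_gt0.
Qed.

(** The inner argument (2 / y) sinh (y s / 2) is the difference quotient at 0 of 2 sinh (y s / 2),
    whose derivative there is s. *)
Lemma cvg_gausskern nu (v : R^nat) (s : R) : (forall n, 0 < v n) ->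
  v n @[n --> \oo] --> 0 ->
  gausskern nu (v n) s @[n --> \oo] --> gauss_fun s.
Proof.
move=> v0 cv; rewrite -[X in _ --> X]mulr1; apply: cvgM.
  apply: (@cvg_comp _ _ _ (fun n => 2 / v n * sinhR (v n / 2 * s)) gauss_fun
    _ (nbhs s)); last exact: continuous_gauss_fun.
  have d : is_derive (0 : R) 1 (fun y => 2 * sinhR (y / 2 * s)) s.
    have d : is_derive (0 : R) 1 (fun y => y / 2 * s) (s / 2).
      by apply: is_derive_eq; rewrite /GRing.scale/=; ring.
    have := @is_derive1_comp _ sinhR (fun y => y / 2 * s) 0 _ _
      (is_derive_sinhR (0 / 2 * s)) d.
    rewrite !mul0r coshR0 => ?.
    by apply: is_derive_eq; rewrite /GRing.scale/=; field.
  have [dd de] := d.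
  have /cvgr_dnbhsP/(_ v) H : h^-1 *: (2 * sinhR ((h *: 1 + 0) / 2 * s)
     - 2 * sinhR (0 / 2 * s)) @[h --> 0^'] --> s by rewrite -[X in _ --> X]de.
  have := H (conj (fun n => lt0r_neq0 (v0 n)) cv).
  apply: cvg_trans; apply: near_eq_cvg; near=> n.
  rewrite !mul0r sinhR0 mulr0 subr0 addr0 [v n *: 1]mulr1.
  by rewrite /GRing.scale/=; ring.
have c0 : nu * v n * s @[n --> \oo] --> (0 : R).
  have <- : nu * 0 * s = 0 by rewrite mulr0 mul0r.
  by apply: cvgM; [apply: cvgM => //|]; exact: cvg_cst.
rewrite -coshR0; apply: (@cvg_comp _ _ _ (fun n => nu * v n * s) coshR _ (nbhs 0)) => //.
exact: coshR_continuous.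
Unshelve. all: by end_near. Qed.

Lemma cvg_Rintegral_gausskern nu (v : R^nat) :
  (forall n, 0 < v n) -> (forall n, v n <= 1) -> v n @[n --> \oo] --> 0 ->
  \int[mu]_(s in `[0, +oo[) gausskern nu (v n) s @[n --> \oo] --> Num.sqrt pi / 2.
Proof.
move=> v0 v1 cv; apply: fine_cvg; rewrite -integral0y_gauss.
apply: (@dominated_cvg _ _ _ mu _ _ (fun n s => (gausskern nu (v n) s)%:E) _
  (EFin \o (fun s => expR ((`|nu| + 1) ^+ 2 / 4) * expR (- s)))) => //.
- by move=> n; apply: (measurable_int mu); exact: gausskern_integrable.
- move=> s _; apply: cvg_EFin; first exact: nearW.
  exact: cvg_gausskern.
- exact: integrable_MexpRN.
- move=> n s; rewrite /= in_itv/= andbT => s0; rewrite lee_fin.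
  exact: gausskern_bound.
Qed.

Lemma cvg_besselKI nu :
  Num.sqrt (2 * x / pi) * expR x * besselKI nu x @[x --> +oo] --> (1 : R).
Proof.
have pi0 := @pi_gt0 R.
have sp0 : 0 < Num.sqrt pi :> R by rewrite sqrtr_gt0.
apply/cvg_pinftyP => u uoo.
(* Truncating below at 2 keeps [v n] at most 1 for every n, as the domination requires; [u n] is
   eventually at least 2, so the limit is unaffected. *)
pose w n := Num.max (u n) 2; pose v n := Num.sqrt (2 / w n).
have w2 n : 2 <= w n by rewrite /w le_max lexx orbT.
have w0 n : 0 < w n by rewrite (lt_le_trans _ (w2 n)).
have v0 n : 0 < v n by rewrite sqrtr_gt0 divr_gt0.
have v1 n : v n <= 1 by rewrite -sqrtr1 ler_sqrt// ler_pdivrMr// mul1r.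
have vw n : w n = 2 / v n ^+ 2.
  by rewrite sqr_sqrtr ?divr_ge0// ?ltW//; field; exact: lt0r_neq0.
have nearw : \forall n \near \oo, w n = u n.
  near=> n; rewrite /w max_l//.
  by near: n; move/cvgryPge : uoo; exact.
have cv : v n @[n --> \oo] --> 0.
  have c0 : 2 / w n @[n --> \oo] --> (0 : R).
    rewrite -[X in _ --> X](mulr0 2); apply: cvgM; first exact: cvg_cst.
    apply: (gtr0_cvgV0 _).2; first by near=> n.
    apply: cvg_trans uoo; apply: near_eq_cvg.
    by near=> n; apply/esym; near: n.
  rewrite -(@sqrtr0 R).
  apply: (@cvg_comp _ _ _ (fun n => 2 / w n) Num.sqrt _ (nbhs 0)) => //.
  exact: sqrt_continuous.
have := cvg_Rintegral_gausskern nu v v0 v1 cv => cJ.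
have {cJ}: 2 / Num.sqrt pi * \int[mu]_(s in `[0, +oo[) gausskern nu (v n) s
    @[n --> \oo] --> 2 / Num.sqrt pi * (Num.sqrt pi / 2).
  by apply: cvgM => //; exact: cvg_cst.
have -> : 2 / Num.sqrt pi * (Num.sqrt pi / 2) = 1 :> R.
  by field; exact: lt0r_neq0.
apply: cvg_trans; apply: near_eq_cvg; near=> n.
have <- : w n = u n by near: n.
have vn0 : v n != 0 by exact: lt0r_neq0.
have sn0 : Num.sqrt pi != 0 :> R by exact: lt0r_neq0.

(* Written in [v n], the prefactor cancels the Jacobian [v n] of the dilation and leaves 2 / sqrt
   pi. *)
have -> : Num.sqrt (2 * w n / pi) = 2 / (v n * Num.sqrt pi).
  rewrite vw; have -> : 2 * (2 / v n ^+ 2) / pi = (2 / v n) ^+ 2 / pi :> R.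
    by rewrite mulrA -expr2 expr_div_n.
  rewrite sqrtrM ?sqr_ge0// sqrtr_sqr sqrtrV ?(ltW pi0)//.
  rewrite ger0_norm ?divr_ge0 ?ltW//.
  by field; rewrite ?vn0 ?sn0.
rewrite vw besselKI_gausskern// expRN; field.
by rewrite ?vn0 ?sn0 ?lt0r_neq0// expR_gt0.
Unshelve. all: by end_near. Qed.

(** The asymptotics give positivity at some large y >= x, and the integral decreases in its argument
    because cosh is positive. *)
Lemma besselKI_gt0 nu x : 0 < x -> 0 < besselKI nu x.
Proof.
move=> x0; near (pinfty_nbhs R) => y.
have xy : x <= y by near: y; apply: nbhs_pinfty_ge; exact: num_real.
have y0 : 0 < y := lt_le_trans x0 xy.
have : 0 < Num.sqrt (2 * y / pi) * expR y * besselKI nu y.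
  by near: y; apply: (cvgr_gt _ (cvg_besselKI nu)).
rewrite pmulr_rgt0; last first.
  by rewrite mulr_gt0 ?expR_gt0// sqrtr_gt0 divr_gt0 ?pi_gt0// mulr_gt0.
move=> /lt_le_trans; apply; apply: le_Rintegral => //.
- by apply: lapker_integrable => //; exact: exp_growth_coshR.
- by apply: lapker_integrable => //; exact: exp_growth_coshR.
move=> t _; rewrite ler_wpM2r ?(ltW (coshR_gt0 _))//.
by rewrite ler_expR lerN2 ler_wpM2r// ltW// coshR_gt0.
Unshelve. all: by end_near. Qed.

End bessel_asymptotics.

(** * Identification of K, U and W with the integral *)

Section identification.
Context {R : realType}.
Implicit Types (x mu nu : R).

(** Replaces the hypotheses at infinity by the normalisation [c]: eventually c u0 <= 2, so E u0^2 <=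
    |M| (c u0)^2 <= 4 |M|, and u / u0 is a quotient of two functions tending to 1. *)
Lemma recessive_unique_weight (p q r E c u0 u : R -> R) (M : R) :
  (forall x, 0 < x -> p x != 0) ->
  (forall x, 0 < x -> 0 < E x /\ is_derive x 1 E (q x / p x * E x)) ->
  (forall x, 0 < x -> 0 < u0 x) ->
  (forall x, 0 < x -> twice_derivable u0 x /\
     p x * derive1n 2 u0 x + q x * derive1 u0 x + r x * u0 x = 0) ->
  (forall x, 0 < x -> twice_derivable u x /\
     p x * derive1n 2 u x + q x * derive1 u x + r x * u x = 0) ->
  (\forall x \near +oo, 0 < c x /\ E x <= M * c x ^+ 2) ->
  c x * u0 x @[x --> +oo] --> (1 : R) ->
  c x * u x @[x --> +oo] --> (1 : R) ->
  forall x, 0 < x -> u x = u0 x.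
Proof.
move=> p0 hE u0_gt0 ode0 ode hc cu0 cu.
apply: (recessive_unique p q r E u0 u (`|M| * 4)) => //.
- near=> x.
  have x0 : 0 < x by near: x; exact: nbhs_pinfty_gt.
  have [c0 EM] : 0 < c x /\ E x <= M * c x ^+ 2 by near: x.
  have cu2 : c x * u0 x <= 2.
    by near: x; apply: (cvgr_le _ cu0); rewrite ltr1n.
  rewrite (le_trans (ler_wpM2r (sqr_ge0 _) EM))// -mulrA -exprMn.
  rewrite (@le_trans _ _ (`|M| * (c x * u0 x) ^+ 2))//.
    by rewrite ler_wpM2r ?sqr_ge0// ler_norm.
  rewrite ler_wpM2l// (_ : 4 = 2 ^+ 2 :> R); last by rewrite expr2 -natrM.
  by rewrite lerXn2r// nnegrE// mulr_ge0 ?ltW// u0_gt0.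
- have h : (c x * u x) / (c x * u0 x) @[x --> +oo] --> (1 : R).
    rewrite -[X in _ --> X](divr1 1); apply: cvgM => //.
    by apply: cvgV => //; exact: oner_neq0.
  apply: cvg_trans h; apply: near_eq_cvg; near=> x.
  have x0 : 0 < x by near: x; exact: nbhs_pinfty_gt.
  have [c0 _] : 0 < c x /\ E x <= M * c x ^+ 2 by near: x.
  have := u0_gt0 x x0 => u00.
  by field; rewrite !lt0r_neq0.
Unshelve. all: by end_near. Qed.

(** A derivative depends only on values nearby, so agreement of [derive1 u] with [u1] on the open
    half-line is enough. *)
Lemma twice_derivable_pos (u u1 u2 : R -> R) :
  (forall x, 0 < x -> is_derive x 1 u (u1 x)) ->
  (forall x, 0 < x -> is_derive x 1 u1 (u2 x)) ->
  forall x, 0 < x ->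
    [/\ twice_derivable u x, derive1 u x = u1 x & derive1n 2 u x = u2 x].
Proof.
move=> du du1 x x0.
have E y : 0 < y -> derive1 u y = u1 y.
  by move=> /du [_ dE]; rewrite derive1E.
have d2 : is_derive x 1 (derive1 u) (u2 x).
  apply: near_eq_is_derive (du1 x x0); near=> y; apply/esym/E.
  by near: y; exact: lt_nbhsr.
have [du2 E2] := d2; have [dux _] := du x x0.
split; [by split; [exact: dux|exact: du2]|exact: E|].
by rewrite derive1nS derive1n1 derive1E; exact: E2.
Unshelve. all: by end_near. Qed.

Lemma besselKI_is_besselK nu : is_besselK nu (besselKI nu).
Proof.
split=> [x x0|]; last exact: cvg_besselKI.
have [tu -> ->] := twice_derivable_pos _ _ _ (is_derive_besselKI nu)
  (is_derive_besselKI1 nu) _ x0.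
by split=> //; exact: besselKI_eq.
Qed.

Lemma besselKE nu x : 0 < x -> besselK nu x = besselKI nu x.
Proof.
have [ode0 cu0] := besselKI_is_besselK nu.
(* The integral witnesses existence, so [xget] returns a genuine solution. *)
have : is_besselK nu (besselK nu).
  by apply: (@xgetPex _ (fun=> 0) [set u | is_besselK nu u]); exists (besselKI nu);
    exact: besselKI_is_besselK.
case=> ode cu; move: x.
(* The weight E = x solves E' = (x / x^2) E, and (pi / 2) c^2 = x exp (2 x) >= x. *)
apply: (recessive_unique_weight (fun x => x ^+ 2) id (fun x => - (x ^+ 2 + nu ^+ 2))
  id (fun x => Num.sqrt (2 * x / pi) * expR x) _ _ (pi / 2)) => //.
- by move=> x x0; rewrite expf_neq0// lt0r_neq0.
- move=> x x0; split => //.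
  have -> : x / x ^+ 2 * x = 1 by field; exact: lt0r_neq0.
  exact: is_derive_id.
- by move=> x; exact: besselKI_gt0.
- by move=> x x0; rewrite mulNr; exact: ode0.
- by move=> x x0; rewrite mulNr; exact: ode.
- near=> x.
  have x0 : 0 < x by near: x; exact: nbhs_pinfty_gt.
  have pi0 := @pi_gt0 R.
  have c0 : 0 < 2 * x / pi by rewrite divr_gt0// mulr_gt0.
  split; first by rewrite mulr_gt0 ?sqrtr_gt0 ?expR_gt0.
  rewrite exprMn sqr_sqrtr ?(ltW c0)// mulrA.
  have pE (p : R) : p != 0 -> p / 2 * (2 * x / p) = x by move=> ?; field.
  rewrite pE ?lt0r_neq0//.
  by rewrite ler_peMr ?(ltW x0)// exprn_ege1// ltW// expR_gt1.
Unshelve. all: by end_near. Qed.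

Definition tricomiUI mu x :=
  (Num.sqrt pi)^-1 * expR (x / 2) * x `^ (- mu) * besselKI mu (x / 2).

Lemma tricomiUI_gt0 mu x : 0 < x -> 0 < tricomiUI mu x.
Proof.
move=> x0; rewrite !mulr_gt0 ?invr_gt0 ?sqrtr_gt0 ?pi_gt0 ?expR_gt0 ?powR_gt0//.
by rewrite besselKI_gt0// divr_gt0.
Qed.

(** The prefactor [P] has logarithmic derivative 1/2 - mu / x, whose own derivative mu / x^2 appears
    in [U2]; [U1] and [U2] are the resulting derivatives. *)
Lemma tricomiUI_kummer mu : kummer_eq (2^-1 + mu) (1 + 2 * mu) (tricomiUI mu).
Proof.
pose P x := (Num.sqrt pi)^-1 * expR (x / 2) * x `^ (- mu).
pose U1 x := P x * ((2^-1 - mu / x) * besselKI mu (x / 2)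
  + besselKI1 mu (x / 2) / 2).
pose U2 x := P x * (((2^-1 - mu / x) ^+ 2 + mu / x ^+ 2) * besselKI mu (x / 2)
  + (2^-1 - mu / x) * besselKI1 mu (x / 2) + besselKI2 mu (x / 2) / 4).
have dhalf x : is_derive x 1 (fun x => x / 2) (1 / 2).
  by apply: is_derive_eq; rewrite /GRing.scale/=; ring.
have dP x : 0 < x -> is_derive x 1 P (P x * (2^-1 - mu / x)).
  move=> x0; have xn0 := lt0r_neq0 x0; rewrite /P.
  have ? := is_derive1_expR_comp _ _ _ (dhalf x).
  have := @is_derive1_powR R (- mu) x x0.
  rewrite powRB ?xn0 ?implybT// powRr1 ?(ltW x0)// => ?.
  move: (Num.sqrt pi)^-1 => c.
  apply: is_derive_eq; rewrite /GRing.scale/=.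
  by move: (x `^ _) (expR _) => *; field.
have dK x : 0 < x ->
    is_derive x 1 (fun x => besselKI mu (x / 2)) (besselKI1 mu (x / 2) / 2).
  move=> x0; have x20 : 0 < x / 2 by rewrite divr_gt0.
  have := @is_derive1_comp _ (besselKI mu) (fun x => x / 2) x _ _
    (is_derive_besselKI mu (x / 2) x20) (dhalf x).
  by rewrite mul1r.
have dK1 x : 0 < x ->
    is_derive x 1 (fun x => besselKI1 mu (x / 2)) (besselKI2 mu (x / 2) / 2).
  move=> x0; have x20 : 0 < x / 2 by rewrite divr_gt0.
  have := @is_derive1_comp _ (besselKI1 mu) (fun x => x / 2) x _ _
    (is_derive_besselKI1 mu (x / 2) x20) (dhalf x).
  by rewrite mul1r.
have dU x : 0 < x -> is_derive x 1 (tricomiUI mu) (U1 x).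
  move=> x0; have ? := dP x x0; have ? := dK x x0.
  have : is_derive x 1 (fun x => P x * besselKI mu (x / 2)) (U1 x).
    apply: is_derive_eq; rewrite /GRing.scale/= /U1.
    by ring.
  by [].
have dU1 x : 0 < x -> is_derive x 1 U1 (U2 x).
  move=> x0; have ? := dP x x0; have ? := dK x x0; have ? := dK1 x x0.
  have xn0 := lt0r_neq0 x0.
  have dV : is_derive x 1 (fun x => 2^-1 - mu / x) (mu / x ^+ 2).
    have ? := is_deriveV (f := id) xn0 (is_derive_id _ _).
    apply: is_derive_eq; rewrite /GRing.scale/=.
    by field.
  rewrite /U1 /U2; apply: is_derive_eq; rewrite /GRing.scale/=.
  move: (besselKI mu (x / 2)) (besselKI1 mu (x / 2)) (besselKI2 mu (x / 2)) (P x).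
  by move=> *; field.
move=> x x0; have [tu -> ->] := twice_derivable_pos _ _ _ dU dU1 x x0.
split=> //; have x20 : 0 < x / 2 by rewrite divr_gt0.
have xn0 := lt0r_neq0 x0.
have := besselKI_eq mu (x / 2) x20.
rewrite /U2 /U1 /tricomiUI -/(P x).
move: (besselKI mu (x / 2)) (besselKI1 mu (x / 2)) (besselKI2 mu (x / 2)) (P x).
move=> K K1 K2 p E.
(* Kummer's expression is P / x times the Bessel expression at x / 2. *)
transitivity (p / x * ((x / 2) ^+ 2 * K2 + x / 2 * K1 - ((x / 2) ^+ 2 + mu ^+ 2) * K)).
  by field.
by rewrite E mulr0.
Qed.

(** Multiplying by x^(1/2 + mu) leaves sqrt (x / pi) exp (x / 2) K(mu, x / 2), which is the Bessel
    normalisation evaluated at x / 2. *)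
Lemma tricomiUI_is_tricomiU mu :
  is_tricomiU (2^-1 + mu) (1 + 2 * mu) (tricomiUI mu).
Proof.
split; first exact: tricomiUI_kummer.
have half : x / 2 @[x --> +oo] --> (+oo : set_system R).
  by apply: gt0_cvgMly => //; exact: cvg_id.
have := cvg_comp _ _ half (cvg_besselKI mu).
apply: cvg_trans; apply: near_eq_cvg; near=> x.
have x0 : 0 < x by near: x; exact: nbhs_pinfty_gt.
rewrite /= /tricomiUI powRD ?lt0r_neq0 ?implybT// powR12_sqrt ?(ltW x0)//.
rewrite powRN [2 * (x / 2)]mulrC divfK ?pnatr_eq0// sqrtrM ?(ltW x0)// sqrtrV ?pi_ge0//.
have := powR_gt0 mu x0 => /lt0r_neq0 ?.
move: (besselKI _ _) (expR _) (Num.sqrt x) (Num.sqrt pi)^-1 => *.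
by field.
Unshelve. all: by end_near. Qed.

Lemma tricomiUE mu x : 0 < x ->
  tricomiU (2^-1 + mu) (1 + 2 * mu) x = tricomiUI mu x.
Proof.
set a := 2^-1 + mu; set b := 1 + 2 * mu.
have b2a : b = a + a by rewrite /a /b; field.
have [ode0 cu0] := tricomiUI_is_tricomiU mu.
have : is_tricomiU a b (tricomiU a b).
  by apply: (@xgetPex _ (fun=> 0) [set u | is_tricomiU a b u]); exists (tricomiUI mu);
    exact: tricomiUI_is_tricomiU.
case=> ode cu; move: x.
(* The weight solves E' = ((b - x) / x) E; as b = 2 a, it equals (x^a)^2 exp (- x), hence is at most
   c^2 and M = 1 suffices. *)
apply: (recessive_unique_weight id (fun x => b - x) (fun=> - a)
  (fun x => x `^ b * expR (- x)) (fun x => x `^ a) _ _ 1) => //.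
- by move=> x x0; exact: lt0r_neq0.
- move=> x x0; have xn0 := lt0r_neq0 x0.
  split; first by rewrite mulr_gt0 ?expR_gt0 ?powR_gt0.
  have ? : is_derive x 1 (fun x => expR (- x)) (- 1 * expR (- x)).
    by apply: is_derive1_expR_comp.
  have := @is_derive1_powR R b x x0.
  rewrite powRB ?xn0 ?implybT// powRr1 ?(ltW x0)// => ?.
  apply: is_derive_eq; rewrite /GRing.scale/=.
  by move: (x `^ _) (expR _) => *; field.
- by move=> x; exact: tricomiUI_gt0.
- by move=> x x0; rewrite mulNr; exact: ode0.
- by move=> x x0; rewrite mulNr; exact: ode.
- near=> x.
  have x0 : 0 < x by near: x; exact: nbhs_pinfty_gt.
  split; first exact: powR_gt0.
  rewrite b2a powRD ?lt0r_neq0 ?implybT// mul1r expr2.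
  by rewrite ler_piMr ?mulr_ge0 ?powR_ge0// expR_le1 oppr_le0 ltW.
Unshelve. all: by end_near. Qed.

Lemma whittakerW0E mu x : 0 < x ->
  whittakerW 0 mu x = Num.sqrt (x / pi) * besselKI mu (x / 2).
Proof.
move=> x0; rewrite /whittakerW subr0 tricomiUE// /tricomiUI.
rewrite powRD ?lt0r_neq0 ?implybT// powR12_sqrt ?(ltW x0)// mulNr expRN powRN.
rewrite sqrtrM ?(ltW x0)// sqrtrV ?pi_ge0//.
have := powR_gt0 mu x0 => /lt0r_neq0 ?.
have := expR_gt0 (x / 2) => /lt0r_neq0 ?.
move: (besselKI _ _) (Num.sqrt x) (Num.sqrt pi)^-1 => *.
by field; apply/andP.
Qed.

End identification.

(** * The derivative in the order, by parity *)

Theorem theorem7 (R : realType) (mu x : R) (hx : 0 < x) :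
  derivable (fun m : R => whittakerW 0 m x) mu 1 /\
  derivable (fun nu : R => besselK nu (x / 2)) `|mu| 1 /\
  derive1 (fun m : R => whittakerW 0 m x) mu =
    Num.sg mu * Num.sqrt (x / pi) *
    derive1 (fun nu : R => besselK nu (x / 2)) `|mu|.
Proof.
have x20 : 0 < x / 2 by rewrite divr_gt0.
have -> : (fun m : R => whittakerW 0 m x) =
    (fun m => Num.sqrt (x / pi) * besselKI m (x / 2)).
  by apply/funext => m; rewrite whittakerW0E.
have -> : (fun nu : R => besselK nu (x / 2)) = (fun nu => besselKI nu (x / 2)).
  by apply/funext => nu; rewrite besselKE.
set K := fun nu => besselKI nu (x / 2).
have [K' dK] : exists K' : R -> R, forall nu : R, is_derive nu 1 K (K' nu).
  exists (fun nu => 'D_1 K nu) => nu.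
  by apply: DeriveDef => //; exact: derivable_besselKI.
have K'N (nu : R) : K' (- nu) = - K' nu.
  (* Differentiating K(- nu) = K(nu) by the chain rule makes the derivative odd. *)
  have KN : K = K \o -%R by apply/funext => z /=; rewrite /K besselKIN.
  have [_ e1] : is_derive nu 1 K (K' (- nu) * -1).
    by rewrite {1}KN; apply: is_derive1_comp; exact: dK.
  have [_ e2] := dK nu.
  by rewrite -e2 e1 mulrN1 opprK.
have dcK : is_derive mu 1 (fun m => Num.sqrt (x / pi) * K m)
    (Num.sqrt (x / pi) * K' mu).
  have ? := dK mu; apply: is_derive_eq.
  by rewrite /GRing.scale/=; ring.
split; first by have [] := dcK.
split; first exact: derivable_besselKI.
rewrite !derive1E; have [_ ->] := dcK; have [_ ->] := dK `|mu|.
rewrite [RHS]mulrAC [RHS]mulrC; congr (_ * _).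
case: (ltgtP mu 0) => [m0|m0|->].
- by rewrite ltr0_sg// ltr0_norm// K'N mulrNN mul1r.
- by rewrite gtr0_sg// gtr0_norm// mul1r.
(* At mu = 0 oddness forces the derivative to vanish, in agreement with sgn(0) = 0. *)
- by rewrite sgr0 mul0r; have := K'N 0; rewrite oppr0 => h; lra.
Qed.
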